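(* Let $\mathbb F$ be a subfield of $\mathbb C$, let $X$ be a nonempty set, and let $A\subseteq\mathbb F^X$ be a function algebra over $\mathbb F$ that contains all the bounded functions in $\mathbb F^X$. Then every element of $A$ is a sum of two units of $A$.
   Context: A function algebra over $\mathbb F$ on a nonempty set $X$ is a subalgebra $A$ of the $\mathbb F$-algebra $\mathbb F^X$ of all functions $X\to\mathbb F$ (pointwise operations) containing the constant function $1$. A unit of $A$ is an element with an inverse in $A$. A function $f\in\mathbb F^X$ is bounded if $\sup_{x\in X}|f(x)|<\infty$, with $|\cdot|$ the usual absolute value on $\mathbb C$. *)

(* Defs.v *)
From mathcomp Require Import all_boot all_order all_algebra.
From mathcomp Require Export complex.
From mathcomp Require Import all_classical all_reals all_analysis.

Set Implicit Arguments.
Unset Strict Implicit.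
Unset Printing Implicit Defensive.

Import GRing.Theory ComplexField.

Local Open Scope classical_set_scope.
Local Open Scope ring_scope.

(* Sums and products of functions are those of the pointwise ring structure
   that mathcomp.classical.functions puts on X -> F.  GRing.subalg_closed is
   not usable for an arbitrary X : Type: lalgType requires 1 != 0. *)
Definition function_algebra (F : fieldType) (X : Type) (A : set (X -> F)) :=
  [/\ A 1,
      forall f g, A f -> A g -> A (f + g),
      forall f g, A f -> A g -> A (f * g)
    & forall (c : F) f, A f -> A (fun x => c * f x)].

Definition unit_of (F : fieldType) (X : Type) (A : set (X -> F)) (u : X -> F) :=
  A u /\ exists2 v, A v & u * v = 1.

(* The supremum is taken in \bar R; normc z is the real number |z|. *)
Definition bounded_function (R : realType) (S : {pred R[i]})
    (F : subFieldType S) (X : Type) (f : X -> F) :=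
  (ereal_sup (range (fun x => (Normc.normc (\val (f x)))%:E)) < +oo)%E.

(* Main.v *)
(** For every [z] in [F] one of [|z - 1|], [|z + 1|] is at least 1, because the
    two numbers differ by 2.  So there is a sign function [s : X -> {1, -1}] with
    [|f - s| >= 1] everywhere; both [s] and [(f - s)^-1] are then bounded, and
    [f = (f - s) + s]. *)
Require Import Defs.
From mathcomp Require Import all_boot all_order all_algebra.
From mathcomp Require Import complex.
From mathcomp Require Import all_classical all_reals all_analysis.
From mathcomp Require Import lra.
Import Order.TTheory GRing.Theory Num.Theory.

Local Open Scope classical_set_scope.
Local Open Scope ring_scope.

(** Trades the extended-real supremum for a uniform real bound, the form in which [s], [- s] and the
    inverse of [f - s] are shown bounded. *)
Lemma le_bounded_function (R : realType) (S : {pred R[i]})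
    (F : subFieldType S) (X : Type) (M : R) (f : X -> F) :
  (forall x, Normc.normc (\val (f x)) <= M) -> bounded_function f.
Proof.
move=> fM; apply: (@le_lt_trans _ _ M%:E); last exact: ltry.
by apply: ge_ereal_sup => _ [x _ <-]; rewrite lee_fin.
Qed.

Lemma normc_sub1_or_add1_ge1 (R : rcfType) (z : R[i]) :
  1 <= Normc.normc (z - 1) \/ 1 <= Normc.normc (z + 1).
Proof.
(* Triangle inequality; the left side is 2, so the two moduli on the right cannot both be below
   1. *)
have : Normc.normc ((z + 1) - (z - 1)) <=
    Normc.normc (z + 1) + Normc.normc (z - 1).
  by rewrite -(normcN (z - 1)); exact: le_normcD.
have -> : z + 1 - (z - 1) = 2%:R by rewrite opprB addrCA addrAC subrr add0r.
have -> : Normc.normc (2%:R : R[i]) = 2%:R.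
  by rewrite normcMn Normc.normc1.
by case: (lerP 1 (Normc.normc (z - 1))) => ?; [left | right; lra].
Qed.

Theorem proposition3p4 (R : realType) (S : {pred R[i]}) (F : subFieldType S)
    (X : Type) (A : set (X -> F)) :
  inhabited X ->
  function_algebra A ->
  (forall f : X -> F, bounded_function f -> A f) ->
  forall f : X -> F, A f ->
    exists u v : X -> F, [/\ unit_of A u, unit_of A v & f = u + v].
Proof.
move=> _ [_ AD _ _] Ab f Af.
pose s x : F := if 1 <= Normc.normc (\val (f x) - 1) then 1 else -1.
have s2 x : s x * s x = 1 by rewrite /s; case: ifP; rewrite ?mulrNN mulr1.
have ns x : Normc.normc (\val (s x)) = 1.
  by rewrite /s; case: ifP; rewrite ?rmorphN ?normcN rmorph1 Normc.normc1.
have nfs x : 1 <= Normc.normc (\val (f x - s x)).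
  (* When the test in [s] fails, [f x - s x] is [f x + 1], and the other alternative of the
     dichotomy applies. *)
  rewrite rmorphB /s; case: ifPn => [|/negbTE h]; rewrite ?rmorphN rmorph1 //.
  by rewrite opprK; case: (normc_sub1_or_add1_ge1 _ (\val (f x))); rewrite ?h.
have As : A s.
  by apply: Ab; apply: (le_bounded_function _ _ _ _ 1) => x; rewrite ns.
(* Membership of [f - s] then follows from closure under sums. *)
have ANs : A (- s).
  apply: Ab; apply: (le_bounded_function _ _ _ _ 1) => x.
  by rewrite rmorphN normcN ns.
exists (f - s), s; split; last by rewrite subrK.
- split; first exact: AD.
  exists (fun x => (f x - s x)^-1).
    apply: Ab; apply: (le_bounded_function _ _ _ _ 1) => x.
    rewrite fmorphV Normc.normcV invf_le1; first exact: nfs.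
    by apply: lt_le_trans (nfs x).
  (* A zero of [f - s] would have modulus 0, against [nfs]. *)
  apply/funext => x; apply: divff; apply: contraTneq (nfs x).
  rewrite -[(f - s) x]/(f x - s x) => ->.
  by rewrite rmorph0 Normc.normc0 -ltNge.
(* Since its values are signs, [s] is its own inverse. *)
- by split => //; exists s => //; apply/funext => x; exact: s2.
Qed.
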